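(* Let $\{G_n\}_{n\ge1}$ be a sequence of graphs with finite diameters satisfying $\mathrm{diam}(G_n)=\omega(1)$, and let $\{r_n\}_{n\ge1}$ be positive integers with $r_n=\varepsilon\cdot\mathrm{diam}(G_n)$. Then $$\lambda_2\big(G_n^{(r_n)}\big)\ge (1-o_\varepsilon(1))\,(r_n+1)\,\hat d_{r_n}(G_n)^{\,r_n/2},$$ where $\hat d_r(G)=\Big(\frac{1}{r+1}\sum_{i=0}^{r}\sqrt{\delta^{(i)}(G)\,\delta^{(r-i)}(G)}\Big)^{2/r}$ and $\delta^{(i)}(G)=\min_{(x,y)\in E(G)}\big|\{v\in V(G): d_G(x,v)=i,\ d_G(y,v)\ge i\}\big|$.
   Context: For a graph $G$ and integer $r\ge1$, $G^{(r)}$ is the graph on $V(G)$ in which two vertices are adjacent iff they are at distance $\le r$ in $G$; its adjacency matrix $A^{(r)}$ has $A^{(r)}_{ij}=1$ iff $d_G(i,j)\le r$ (diagonal entries $1$), and $\lambda_2(G^{(r)})$ denotes the second largest eigenvalue of $A^{(r)}$. The minimum defining $\delta^{(i)}$ is over ordered pairs $(x,y)$ of adjacent vertices. $o_\varepsilon(1)$ denotes a quantity tending to $0$ as $\varepsilon\to0$. *)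

(* Defs.v *)
From HB Require Import structures.
From mathcomp Require Import all_boot all_order all_algebra.
From mathcomp Require Import reals exp.
Set Implicit Arguments. Unset Strict Implicit. Unset Printing Implicit Defensive.
Import Order.TTheory GRing.Theory Num.Theory.
Local Open Scope ring_scope.

Definition simple_graph (T : finType) (adj : rel T) : Prop :=
  (forall x y, adj x y = adj y x) /\ (forall x, ~~ adj x x).

Fixpoint ball (T : finType) (adj : rel T) (k : nat) (x : T) : {set T} :=
  match k with
  | 0 => [set x]
  | k'.+1 => ball adj k' x :|: [set v | [exists u in ball adj k' x, adj u v]]
  end.

Definition connected_graph (T : finType) (adj : rel T) : Prop :=
  forall x y : T, exists k, y \in ball adj k x.

(* graph distance d_G(x,y): least k with y in the k-ball of x (for connected
   graphs every such distance is < #|T|; the value #|T| is a sentinel for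
   unreachable vertices, which never occurs for connected graphs). *)
Definition dist (T : finType) (adj : rel T) (x y : T) : nat :=
  find (fun k => y \in ball adj k x) (iota 0 #|T|).

Definition diam (T : finType) (adj : rel T) : nat :=
  \max_(x : T) \max_(y : T) dist adj x y.

(* delta^{(i)}(G) = min over ordered adjacent pairs (x,y) of
   |{v : d(x,v) = i, d(y,v) >= i}|  (default #|T| if there are no edges) *)
Definition delta_i (T : finType) (adj : rel T) (i : nat) : nat :=
  \big[minn/#|T|]_(p : T * T | adj p.1 p.2)
     #|[set v | (dist adj p.1 v == i) && (i <= dist adj p.2 v)%N]|.

Definition hat_d (R : realType) (T : finType) (adj : rel T) (r : nat) : R :=
  powR ((r.+1)%:R^-1 *
        \sum_(0 <= i < r.+1)
           Num.sqrt ((delta_i adj i)%:R * (delta_i adj (r - i))%:R))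
       (2 / r%:R).

(* adjacency matrix of G^{(r)}: entry 1 iff d_G(i,j) <= r (diagonal 1) *)
Definition distpow_mx (R : realType) (T : finType) (adj : rel T) (r : nat)
  : 'M[R]_#|T| :=
  \matrix_(i, j) (dist adj (enum_val i) (enum_val j) <= r)%N%:R.

Definition is_lambda2 (R : realType) (n : nat) (A : 'M[R]_n) (l : R) : Prop :=
  exists s : seq R,
    [/\ size s = n, sorted (fun a b => b <= a) s,
        char_poly A = \prod_(x <- s) ('X - x%:P) & l = nth 0 s 1].

(* Main.v *)
Require Import Defs.
From HB Require Import structures.
From mathcomp Require Import all_boot all_order all_algebra.
From mathcomp Require Import reals exp complex spectral.
From mathcomp Require Import ring lra zify.
Import Order.TTheory GRing.Theory Num.Theory.
Local Open Scope ring_scope.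

Set Implicit Arguments.
Unset Strict Implicit.
Unset Printing Implicit Defensive.

(** Write A for the matrix of G^(r), delta_i for delta^(i), a_i for
    sqrt (delta_i delta_(r-i)) and S for the sum of the a_i, so that
    the claim is lambda_2 >= (1 - o(1)) S; we prove it with error 1000 eps.

    Fix a vertex o.  From v in the ball B(o,k), follow a walk
    v = x_0, x_1, ... with x_i in B(o,k-i).  The sets
    {w : d(x_i,w) = r-i, d(x_(i+1),w) >= r-i} are disjoint for distinct i,
    lie in B(v,r) and in B(o,k+r-2i), and have at least delta_(r-i) elements.
    Hence A^m dominates, from ball to ball, the m-th power of the Toeplitz
    matrix on levels whose entry for the step r-2i is delta_(r-i).  As A is
    symmetric the transposed bound holds as well, and the geometric mean of
    the two is the m-th power of the symmetric Toeplitz matrix with entries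
    a_i, all of whose row sums away from the boundary are S^m.

    Levels k of a window of length 4mr are grouped into blocks according to
    log_4 |B(o,k)|.  Combining the normalised indicators of the block balls,
    which are almost orthogonal, gives f with <f, A^m f> >= (S^m / 24) |f|^2,
    where the constant does not depend on r.  Two vertices at distance about
    r / eps carry two such functions whose supports do not interact under
    A^m for odd m of order 1 / eps, so lambda_2^m >= S^m / 24, and the m-th
    root makes the constant harmless. *)

(** * A variational lower bound for the second eigenvalue of a real symmetric matrix *)

Local Notation toC := (@real_complex _).

Lemma expmx_sym (R : comPzRingType) n (A : 'M[R]_n) m : A^T = A -> (A ^+ m)^T = A ^+ m.
Proof.
by move=> symA; elim: m => [|m IH]; rewrite ?expr0 ?trmx1 // {1}exprS exprSr trmx_mul IH symA.
Qed.

Lemma char_poly_conj (F : comUnitRingType) n (P D : 'M[F]_n) :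
  P \in unitmx -> char_poly (invmx P *m D *m P) = char_poly D.
Proof.
move=> uP; pose Q := map_mx (@polyC F) P; pose Q' := map_mx (@polyC F) (invmx P).
have QQ : Q' *m Q = 1%:M by rewrite -map_mxM mulVmx // map_mx1.
have -> : char_poly (invmx P *m D *m P) = \det (Q' *m char_poly_mx D *m Q).
  rewrite /char_poly /char_poly_mx !map_mxM mulmxBr mulmxBl -/Q -/Q'.
  by rewrite scalar_mxC -[_ *m Q' *m Q]mulmxA QQ mulmx1.
by rewrite !det_mulmx mulrAC -det_mulmx QQ det1 mul1r.
Qed.

Lemma count_gt_nth1 (R : realDomainType) (s : seq R) :
  sorted (fun a b => b <= a) s -> (count (fun x => (nth 0 s 1 < x)%R) s <= 1)%N.
Proof.
case: s => [//|a [|b s]] /=; first by rewrite addn0 leq_b1.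
case/andP=> _ bs; rewrite ltxx add0n.
suff -> : count (fun x => b < x) s = 0%N by rewrite addn0 leq_b1.
apply/eqP; rewrite -leqn0 leqNgt -has_count; apply/hasPn => x xs.
rewrite -leNgt; move: bs; rewrite (path_sortedE (rev_trans le_trans)).
by case/andP=> /allP/(_ _ xs).
Qed.

Lemma ler_odd_exp (R : realDomainType) (m : nat) (x y : R) :
  odd m -> x <= y -> x ^+ m <= y ^+ m.
Proof.
move=> om xy; have [x0|x0] := leP 0 x.
  by rewrite lerXn2r // nnegrE // (le_trans x0).
have [y0|y0] := leP 0 y.
  by rewrite (@le_trans _ _ 0) ?exprn_ge0 // exprn_odd_le0 // ltW.
rewrite -[x]opprK -[y]opprK exprNn [X in _ <= X]exprNn -signr_odd om expr1 !mulN1r lerN2.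
by apply: lerXn2r; rewrite ?nnegrE ?oppr_ge0 ?lerN2 // ltW.
Qed.

Lemma diag_mx_form (C : numClosedFieldType) n (w D : 'rV[C]_n) :
  (w *m diag_mx D *m (map_mx Num.conj w)^T) 0 0 = \sum_i D 0 i * `|w 0 i| ^+ 2.
Proof.
rewrite mxE; apply: eq_bigr => i _.
by rewrite mul_mx_diag !mxE normCK mulrA [D 0 i * _]mulrC.
Qed.

(** The two imaginary cross terms cancel because [N] is symmetric. This brings the form of a complex
    vector, where the spectral theorem applies, back to two real vectors. *)
Lemma real_complex_form (R : rcfType) n (N : 'M[R]_n) (x y : 'rV[R]_n)
    (z := map_mx toC x + 'i *: map_mx toC y) :
  N^T = N ->
  (z *m map_mx toC N *m (map_mx Num.conj z)^T) 0 0
    = toC ((x *m N *m x^T) 0 0 + (y *m N *m y^T) 0 0).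
Proof.
move=> symN.
have zc : map_mx Num.conj z = map_mx toC x - 'i *: map_mx toC y.
  apply/matrixP=> i j; rewrite !mxE rmorphD rmorphM /= conjCi mulNr.
  have real_conj (t : R) : Num.conj (toC t) = toC t.
    by apply/CrealP; apply/complex_realP; exists t.
  by rewrite !real_conj.
have cross : x *m N *m y^T = y *m N *m x^T.
  transitivity ((y *m N *m x^T)^T); first by rewrite !trmx_mul trmxK symN mulmxA.
  by apply/matrixP=> i j; rewrite [LHS]mxE !ord1.
rewrite zc linearB /= linearZ /= !map_trmx /z.
rewrite !mulmxDl !mulmxBr -!scalemxAl -!scalemxAr -!map_mxM cross.
set a := map_mx _ _; set b := map_mx _ _; set c := map_mx _ _.
have -> : a - 'i *: b + ('i *: b - 'i *: ('i *: c)) = a + c.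
  rewrite scalerA -expr2 sqrCi scaleN1r opprK addrA; congr (_ + _).
  by rewrite subrK.
by rewrite rmorphD [LHS]mxE [a _ _]mxE [c _ _]mxE.
Qed.


(** Diagonalisation takes place over the complex numbers. The eigenvalues [d i] are real because the
    characteristic polynomial splits over [R]; as [l] is the second entry of the sorted spectrum, at
    most one index exceeds it. *)
Lemma spectral_lambda2 (R : realType) n (A : 'M[R]_n) (l : R)
    (AC := map_mx toC A) (P := spectralmx AC) :
  (0 < n)%N -> A^T = A -> is_lambda2 A l -> exists d : 'I_n -> R,
    AC = invmx P *m diag_mx (\row_i toC (d i)) *m P /\
    exists i0, forall i, i != i0 -> d i <= l.
Proof.
move=> n0 symA [s [sz_s sorted_s cpA ->]].
have nAC : AC \is normalmx.
  apply/hermitian_normalmx/realsym_hermsym.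
    by apply/is_hermitianmxP; rewrite expr0 scale1r map_mx_id // /AC map_trmx symA.
  by apply/mxOverP=> i j; rewrite mxE; apply/complex_realP; exists (A i j).
have ACE := orthomx_spectralP nAC; rewrite -/P in ACE.
set D := spectral_diag AC in ACE.
have cpD : \prod_(x <- [seq D 0 i | i <- enum 'I_n]) ('X - x%:P)
         = \prod_(x <- map toC s) ('X - x%:P).
  have -> : \prod_(x <- map toC s) ('X - x%:P) = char_poly AC.
    rewrite /AC -map_char_poly cpA rmorph_prod big_map; apply: eq_bigr => x _ /=.
    by rewrite rmorphB /= map_polyX map_polyC.
  rewrite [in RHS]ACE char_poly_conj ?spectral_unit // char_poly_trig ?diag_mx_is_trig //.
  rewrite big_map big_enum; apply: eq_bigr => i _.
  by rewrite mxE eqxx mulr1n.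
have pD := prod_XsubC_eq cpD.
pose d i := complex.Re (D 0 i).
have dE i : toC (d i) = D 0 i.
  have : D 0 i \in map toC s by rewrite -(perm_mem pD) map_f // mem_enum.
  by case/mapP=> x _ E; rewrite /d E.
have pd : perm_eq [seq d i | i <- enum 'I_n] s.
  have := perm_map (@complex.Re R) pD; rewrite -!map_comp.
  by rewrite [X in perm_eq _ X]map_id.
exists d; split.
  have -> : \row_i toC (d i) = D by apply/rowP=> i; rewrite mxE dE.
  exact: ACE.
have := count_gt_nth1 sorted_s; rewrite -(permP pd) count_map.
set Q := preim _ _ => cQ.
have uQ i j : Q i -> Q j -> i = j.
  move=> Qi Qj; have /card_le1_eqP : (#|Q| <= 1)%N by rewrite cardE size_filter -enumT.
  by apply.
have [i0 Qi0|noQ] := pickP Q.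
  exists i0 => i ne; rewrite leNgt; apply/negP => Qi.
  by rewrite (uQ i i0) ?eqxx in ne.
by exists (Ordinal n0) => i _; rewrite leNgt; apply/negP => Qi; have := noQ i; rewrite /Q /= Qi.
Qed.

(** Courant-Fischer for a plane: some nonzero combination of [f] and [g] has no component at the
    exceptional index [i0], and off [i0] the form of [A ^+ m - mu] would be negative definite if
    [l ^+ m < mu]. Oddness of [m] gives [d i ^+ m <= l ^+ m] for negative [d i] too. *)
Lemma lambda2_minmax (R : realType) n (A : 'M[R]_n) (l mu : R) (m : nat)
    (f g : 'rV[R]_n) :
  A^T = A -> is_lambda2 A l -> odd m ->
  (forall a b, mu * ((a *: f + b *: g) *m (a *: f + b *: g)^T) 0 0
     <= ((a *: f + b *: g) *m A ^+ m *m (a *: f + b *: g)^T) 0 0) ->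
  (forall a b, a *: f + b *: g = 0 -> a = 0 /\ b = 0) ->
  mu <= l ^+ m.
Proof.
move=> symA lA om quad indep; rewrite leNgt; apply/negP => lt_l.
have n0 : (0 < n)%N.
  case: n f g {A symA lA quad} indep => [|//] f g indep.
  have [|/eqP] := indep 1 0; first by rewrite thinmx0.
  by rewrite oner_eq0.
have [d [ACE [i0 dle]]] := spectral_lambda2 n0 symA lA.
set P := spectralmx _ in ACE.
have uP : P \in unitmx by exact: spectral_unit.
have PV : invmx P = (map_mx Num.conj P)^T.
  by rewrite invmx_unitary ?spectral_unitarymx // map_trmx.
pose N := A ^+ m - mu%:M.
have symN : N^T = N by rewrite /N linearB /= tr_scalar_mx expmx_sym.
have NE : map_mx toC N = invmx P *m diag_mx (\row_i toC (d i ^+ m - mu)) *m P.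
  have Am : map_mx toC (A ^+ m) = invmx P *m diag_mx (\row_i toC (d i ^+ m)) *m P.
    elim: m {om quad lt_l N symN} => [|m IH].
      rewrite expr0 map_mx1; set D := diag_mx _.
      have -> : D = 1%:M by apply/matrixP=> i j; rewrite !mxE expr0 rmorph1.
      by rewrite mulmx1 mulVmx.
    rewrite exprS map_mxM IH ACE !mulmxA; congr (_ *m _).
    rewrite -[_ *m P *m _]mulmxA mulmxV // mulmx1 -mulmxA mulmx_diag.
    congr (_ *m diag_mx _); apply/rowP=> i; rewrite !mxE -rmorphM -exprS //.
  rewrite /N map_mxB Am map_scalar_mx.
  have -> : (toC mu)%:M = invmx P *m (toC mu)%:M *m P :> 'M_n.
    by rewrite scalar_mxC -mulmxA mulVmx // mulmx1.
  set D := diag_mx _; set D' := diag_mx _.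
  have -> : D' = D - (toC mu)%:M by apply/matrixP=> i j; rewrite !mxE rmorphB mulrnBl.
  by rewrite mulmxBr mulmxBl.
pose u := (map_mx toC f *m invmx P) 0 i0; pose v := (map_mx toC g *m invmx P) 0 i0.
(* The eigenvectors are complex, so the coefficients that kill coordinate [i0] are complex as well;
   the real and imaginary parts [x] and [y] of [z] still lie in the real span of [f] and [g]. *)
have [[a b] /= ab0 abuv] : exists2 ab : R[i] * R[i], ab != (0, 0) & ab.1 * u + ab.2 * v = 0.
  have [/eqP u0|u0] := boolP (u == 0).
    by exists (1, 0); rewrite ?u0 ?mulr0 ?mul0r ?addr0 // xpair_eqE oner_eq0.
  by exists (v, - u); rewrite ?xpair_eqE ?oppr_eq0 ?(negPf u0) ?andbF //= mulrC mulNr subrr.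
pose x := complex.Re a *: f + complex.Re b *: g.
pose y := complex.Im a *: f + complex.Im b *: g.
pose z := map_mx toC x + 'i *: map_mx toC y.
have zE : z = a *: map_mx toC f + b *: map_mx toC g.
  have cE (c : R[i]) : c = toC (complex.Re c) + 'i * toC (complex.Im c).
    by rewrite {1}[c]complexE.
  apply/rowP=> j; rewrite !mxE !rmorphD !rmorphM {3}(cE a) {3}(cE b).
  ring.
pose w := z *m invmx P.
have w0 : w 0 i0 = 0.
  by rewrite /w zE mulmxDl -!scalemxAl mxE [X in X + _]mxE [X in _ + X]mxE.
have form_ge0 : 0 <= (x *m N *m x^T) 0 0 + (y *m N *m y^T) 0 0.
  have aux s t : 0 <= ((s *: f + t *: g) *m N *m (s *: f + t *: g)^T) 0 0.
    rewrite /N mulmxBr mulmxBl mul_mx_scalar -scalemxAl [X in 0 <= X]mxE.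
    by rewrite [X in _ + X]mxE [X in _ - X]mxE subr_ge0.
  by rewrite addr_ge0 ?aux.
have := real_complex_form x y symN; rewrite -/z.
have -> : z *m map_mx toC N *m (map_mx Num.conj z)^T
   = w *m diag_mx (\row_i toC (d i ^+ m - mu)) *m (map_mx Num.conj w)^T.
  rewrite NE /w !mulmxA -mulmxA; congr (_ *m _).
  rewrite map_mxM trmx_mul PV; congr (_ *m _).
  by apply/matrixP=> i j; rewrite !mxE /= conjCK.
have -> : (w *m diag_mx (\row_i toC (d i ^+ m - mu)) *m (map_mx Num.conj w)^T) 0 0
   = \sum_i toC (d i ^+ m - mu) * `|w 0 i| ^+ 2.
  by rewrite diag_mx_form; apply: eq_bigr => i _; rewrite [in LHS]mxE.
move=> sumE.
have lt_d i : i != i0 -> d i ^+ m < mu.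
  by move=> /dle di; apply: le_lt_trans lt_l; exact: ler_odd_exp.
have term_ge0 i : 0 <= toC (mu - d i ^+ m) * `|w 0 i| ^+ 2.
  have [->|ne] := eqVneq i i0; first by rewrite w0 normr0 expr0n mulr0.
  by rewrite mulr_ge0 ?exprn_ge0 // lecR subr_ge0 ltW ?lt_d.
(* The terms are nonnegative while their sum is minus a nonnegative form, so each of them
   vanishes. *)
have sum0 : \sum_i toC (mu - d i ^+ m) * `|w 0 i| ^+ 2 = 0.
  apply/eqP; rewrite eq_le sumr_ge0 ?andbT //.
  have -> : \sum_i toC (mu - d i ^+ m) * `|w 0 i| ^+ 2
      = - \sum_i toC (d i ^+ m - mu) * `|w 0 i| ^+ 2.
    by rewrite -sumrN; apply: eq_bigr => i _; rewrite -mulNr -rmorphN opprB.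
  by rewrite sumE oppr_le0 lecR.
have wz : w = 0.
  apply/rowP=> i; rewrite [RHS]mxE; have [->//|ne] := eqVneq i i0.
  have /eqP : toC (mu - d i ^+ m) * `|w 0 i| ^+ 2 = 0.
    exact: (psumr_eq0P (fun i _ => term_ge0 i) sum0 isT).
  rewrite mulf_eq0 expf_eq0 normr_eq0 /= => /orP[|/eqP//].
  by rewrite fmorph_eq0 subr_eq0 gt_eqF ?lt_d.
have z0 : z = 0 by rewrite -(mulmxKV uP z) -/w wz mul0mx.
have x0 : x = 0.
  apply/rowP=> i; have /rowP/(_ i) := z0; rewrite !mxE => /(congr1 (@complex.Re _)).
  by rewrite /= => <-; ring.
have y0 : y = 0.
  apply/rowP=> i; have /rowP/(_ i) := z0; rewrite !mxE => /(congr1 (@complex.Im _)).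
  by rewrite /= => <-; ring.
have [ra rb] := indep _ _ x0; have [ia ib] := indep _ _ y0.
move: ab0; rewrite [a]complexE [b]complexE ra rb ia ib.
by rewrite !mulr0 !addr0 eqxx.
Qed.

(** * Graph distance, walks towards a centre, and their branches *)

Section Distance.
Variables (T : finType) (adj : rel T).
Hypotheses (simple : simple_graph adj) (conn : connected_graph adj).
Local Open Scope nat_scope.
Local Notation d := (dist adj).

Lemma ballP k x y : reflect
  (exists p, [/\ path adj x p, last x p = y & size p <= k]) (y \in ball adj k x).
Proof.
elim: k y => [|k IH] y /=.
  rewrite inE; apply: (iffP eqP) => [->|[[|a p] [_ <-]] //]; by exists [::].
rewrite !inE; apply: (iffP orP) => [[/IH[p [pp lp sp]]|]|].
- by exists p; rewrite pp lp leqW.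
- case/existsP=> u /andP[/IH[p [pp lp sp]] uy]; exists (rcons p y).
  by rewrite rcons_path pp lp uy last_rcons size_rcons.
case=> p [pp lp]; rewrite leq_eqVlt => /orP[/eqP sp|sp]; last first.
  by left; apply/IH; exists p; rewrite pp lp.
right; case/lastP: p pp lp sp => [//|p z].
rewrite rcons_path last_rcons size_rcons => /andP[pp az] zy [sp].
apply/existsP; exists (last x p); rewrite -zy az andbT.
by apply/IH; exists p; rewrite pp sp.
Qed.

(** A walk shortened to a simple path has fewer than [#|T|] steps, so the search defining [dist]
    succeeds and never returns its sentinel. *)
Lemma dist_le k x y : (d x y <= k) = (y \in ball adj k x).
Proof.
have hasE : has (fun k => y \in ball adj k x) (iota 0 #|T|).
  have [j /ballP[p [pp lp _]]] := conn x y.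
  case/shortenP: pp lp => q qq uq _ lq; apply/hasP; exists (size q).
    rewrite mem_iota add0n /=; have := card_uniqP uq => /= <-; exact: max_card.
  by apply/ballP; exists q; split=> //.
have fd : d x y < #|T| by rewrite -[X in _ < X](size_iota 0) -has_find.
apply/idP/idP => [le_k|].
  have := nth_find 0 hasE; rewrite nth_iota // add0n => /ballP[p [pp lp sp]].
  by apply/ballP; exists p; split=> //; apply: leq_trans le_k.
move=> yk; rewrite leqNgt; apply/negP => lt_k.
have := before_find 0 lt_k; rewrite nth_iota ?add0n ?yk //.
exact: ltn_trans fd.
Qed.

Lemma dist_sym x y : d x y = d y x.
Proof.
suff le z t : d z t <= d t z by apply/eqP; rewrite eqn_leq !le.
rewrite dist_le; have : d t z <= d t z by [].
rewrite {1}dist_le => /ballP[p [pp lp sp]].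
apply/ballP; exists (rev (belast t p)); rewrite size_rev size_belast sp.
rewrite -{1}lp rev_path; split=> //.
  by rewrite (eq_path (e' := adj)) // => a b /=; rewrite simple.1.
by rewrite -lp; case: p {pp lp sp} => //= a p; rewrite rev_cons last_rcons.
Qed.

Lemma dist_triangle x y z : d x z <= d x y + d y z.
Proof.
have : d x y <= d x y by []. rewrite {1}dist_le => /ballP[p [pp lp sp]].
have : d y z <= d y z by []. rewrite {1}dist_le => /ballP[q [pq lq sq]].
rewrite dist_le; apply/ballP; exists (p ++ q).
by rewrite cat_path last_cat lp pp pq lq size_cat leq_add.
Qed.

Lemma distxx x : d x x = 0.
Proof. by apply/eqP; rewrite -leqn0 dist_le inE. Qed.

Lemma dist_adj x y : adj x y -> d x y <= 1.
Proof. by move=> xy; rewrite dist_le; apply/ballP; exists [:: y]; rewrite /= xy. Qed.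

Lemma closer_neighbor o v : v != o -> exists2 u, adj v u & d o u <= (d o v).-1.
Proof.
move=> vo; have : d v o <= d v o by [].
rewrite {1}dist_le => /ballP[[|u p] [/= pp lp sp]]; first by rewrite lp eqxx in vo.
case/andP: pp => vu pu; exists u => //; rewrite (dist_sym o v) (dist_sym o u) dist_le.
by apply/ballP; exists p; rewrite pu lp; split=> //; case: (d v o) sp.
Qed.

Lemma has_neighbor o w : w != o -> exists u, adj o u.
Proof. by rewrite eq_sym => /closer_neighbor[u]; exists u. Qed.

(** Away from [o] a geodesic supplies the neighbour. At [o] itself any neighbour is within distance
    1, which fits because [k.-1] is positive. *)
Lemma step_neighbor o w v k : w != o -> 2 <= k -> d o v <= k ->
  exists2 u, adj v u & d o u <= k.-1.
Proof.
move=> wo k2 ovk; have [->|vo] := eqVneq v o.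
  have [u ou] := has_neighbor wo; exists u => //.
  by apply: leq_trans (dist_adj ou) _; case: k k2 {ovk} => [|[|]].
have [u vu ou] := closer_neighbor vo; exists u => //.
by apply: leq_trans ou _; lia.
Qed.

Lemma descending_walk o w v k r : w != o -> r + 3 <= k -> d o v <= k ->
  exists x : nat -> T, [/\ x 0 = v,
    forall i, i <= r -> adj (x i) (x i.+1) & forall i, i <= r -> d o (x i) <= k - i].
Proof.
move=> wo kr ovk.
(* The default [p] is not taken for [i <= r]: there [r + 3 <= k] keeps [k - i] at least 2, so
   [step_neighbor] provides a candidate. *)
pose x i := iteri i (fun j p => odflt p [pick u | adj p u && (d o u <= k - j.+1)]) v.
have xS i : i <= r -> d o (x i) <= k - i ->
    adj (x i) (x i.+1) /\ d o (x i.+1) <= k - i.+1.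
  move=> ir oxi; rewrite /x /=; case: pickP => [u /andP[] //|no].
  have k2 : 2 <= k - i by lia.
  have [u xu ou] := step_neighbor wo k2 oxi.
  by have := no u; rewrite xu /= subnS ou.
have xd i : i <= r -> d o (x i) <= k - i.
  elim: i => [|i IH] ir; first by rewrite subn0.
  by have [] := xS i (ltnW ir) (IH (ltnW ir)).
exists x; split=> // i ir; by have [] := xS i ir (xd i ir).
Qed.

(** The set whose minimum size over edges is [delta_i adj (r - i)], taken at the [i]-th edge of the
    walk. *)
Definition branch (r : nat) (x : nat -> T) (i : nat) : {set T} :=
  [set v | (d (x i) v == r - i) && (r - i <= d (x i.+1) v)].

Lemma delta_le x y i : adj x y ->
  delta_i adj i <= #|[set v | (d x v == i) && (i <= d y v)]|.
Proof.
move=> xy; rewrite /delta_i.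
have : (x, y) \in index_enum (T * T)%type by rewrite mem_index_enum.
elim: (index_enum _) => [//|p s IH]; rewrite inE big_cons.
case/orP => [/eqP <- /=|/IH le]; first by rewrite xy geq_minl.
by case: ifP => // _; apply: leq_trans (geq_minr _ _) le.
Qed.

(* Along the walk [d (x j) v + j] is nondecreasing, and it equals [r] at [i] but
   exceeds [r] at [i.+1]; hence [v] determines [i]. *)
Lemma branch_disjoint r x v i j :
  (forall i, i <= r -> adj (x i) (x i.+1)) -> i <= r -> j <= r ->
  v \in branch r x i -> v \in branch r x j -> i = j.
Proof.
move=> ax; wlog lt_ij : i j / i < j => [wl|].
  by case: (ltngtP i j) => // ij ir jr vi vj; [|symmetry]; apply: wl.
move=> ir jr; rewrite !inE => /andP[_ vi] /andP[/eqP vj _].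
have mono k : i.+1 + k <= j -> d (x i.+1) v + i.+1 <= d (x (i.+1 + k)) v + (i.+1 + k).
  elim: k => [|k IH] kj; first by rewrite addn0.
  have kr : i.+1 + k <= r by lia.
  have := dist_triangle (x (i.+1 + k)) (x (i.+1 + k).+1) v.
  have := dist_adj (ax _ kr); rewrite -addnS in IH *; rewrite addnS.
  by move=> *; have := IH; lia.
have := mono (j - i.+1); rewrite subnKC // => /(_ (leqnn _)); lia.
Qed.

Lemma branch_ball r x v i :
  (forall i, i <= r -> adj (x i) (x i.+1)) -> i <= r ->
  v \in branch r x i -> d (x 0) v <= r.
Proof.
move=> ax ir; rewrite inE => /andP[/eqP vi _].
have le k : k <= r -> d (x 0) (x k) <= k.
  elim: k => [|k IH] kr; first by rewrite distxx.
  have := dist_triangle (x 0) (x k) (x k.+1); have := dist_adj (ax _ (ltnW kr)).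
  have := IH (ltnW kr); lia.
have := dist_triangle (x 0) (x i) v; have := le i ir; lia.
Qed.

End Distance.

(** * Domination of powers of a Toeplitz matrix on levels *)

Section LevelComparison.
Variables (R : realType) (T : finType) (adj : rel T) (r : nat).
Hypotheses (simple : simple_graph adj) (conn : connected_graph adj).
Local Notation d := (dist adj).
Local Notation delta i := ((delta_i adj i)%:R : R).

(** The matrix of G^(r) acting on functions of vertices, free of the enumeration that indexes
    [distpow_mx]. *)
Definition distpow_op (F : T -> R) : T -> R :=
  fun v => \sum_(w | (d v w <= r)%N) F w.

Lemma distpow_op_ge0 F : (forall v, 0 <= F v) -> forall v, 0 <= distpow_op F v.
Proof. by move=> F0 v; apply: sumr_ge0. Qed.

Lemma iter_distpow_op_ge0 m F : (forall v, 0 <= F v) ->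
  forall v, 0 <= iter m distpow_op F v.
Proof. by move=> F0; elim: m => [//|m IH] v /=; apply: distpow_op_ge0. Qed.

(** The branches along a descending walk from [v] are disjoint subsets of the [r]-ball of [v].
    Branch [i] has at least [delta (r - i)] vertices, all within [k - i + (r - i)] of [o], where [G]
    is at least [W i]. *)
Lemma branching_step (o w v : T) (k : nat) (G : T -> R) (W : nat -> R) :
  w != o -> (r + 3 <= k)%N -> (d o v <= k)%N ->
  (forall u, 0 <= G u) -> (forall i, 0 <= W i) ->
  (forall i u, (i <= r)%N -> (d o u <= k - i + (r - i))%N -> W i <= G u) ->
  \sum_(i < r.+1) delta (r - i) * W i <= distpow_op G v.
Proof.
move=> wo kr ovk G0 W0 WG.
have [x [x0 ax ox]] := descending_walk simple conn wo kr ovk.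
have card_le (i : 'I_r.+1) :
    delta (r - i) * W i <= \sum_u (u \in branch adj r x i)%:R * G u.
  have ir : (i <= r)%N by rewrite -ltnS.
  apply: (@le_trans _ _ (#|branch adj r x i|%:R * W i)).
    by rewrite ler_wpM2r // ler_nat; apply: delta_le; exact: ax.
  rewrite mulr_natl -sumr_const big_mkcond /=; apply: ler_sum => u _.
  case: ifP => ub; last by rewrite mul0r.
  rewrite mul1r; apply: WG => //.
  move: ub; rewrite inE => /andP[/eqP xu _].
  have := dist_triangle conn o (x i) u; have := ox _ ir; lia.
apply: le_trans (ler_sum _ (fun i _ => card_le i)) _.
rewrite exchange_big /distpow_op [X in _ <= X]big_mkcond /=.
apply: ler_sum => u _; rewrite -mulr_suml.
(* By disjointness at most one index survives for each [u], so [G u] is counted at most once. *)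
have [i ui|nou] := pickP (fun i : 'I_r.+1 => u \in branch adj r x i); last first.
  rewrite big1 ?mul0r => [|i _]; last by rewrite nou.
  by case: ifP => // _; apply: G0.
have le_r (j : 'I_r.+1) : (j <= r)%N by rewrite -ltnS.
rewrite (bigD1 i) //= ui big1 => [|j ne]; last first.
  case: (boolP (u \in _)) => // uj; case/eqP: ne; apply: val_inj.
  exact: (branch_disjoint conn ax (le_r j) (le_r i) uj ui).
by rewrite addr0 mul1r -x0 (branch_ball conn ax (le_r i) ui).
Qed.

(** Toeplitz matrix with weight [a i] on the step [r - 2i]. The equation is additive because the
    target level [k + r - 2i] may be negative. *)
Definition level_mx (L : nat) (a : nat -> R) : 'M[R]_L :=
  \matrix_(k, l) \sum_(i < r.+1) (l + i == k + (r - i))%N%:R * a i.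

Lemma level_mx_ge0 L a k l : (forall i, 0 <= a i) -> 0 <= level_mx L a k l.
Proof. by move=> a0; rewrite mxE; apply: sumr_ge0 => i _; rewrite mulr_ge0. Qed.

Lemma mulmx_ge0 p q s (M : 'M[R]_(p, q)) (N : 'M[R]_(q, s)) :
  (forall i j, 0 <= M i j) -> (forall i j, 0 <= N i j) ->
  forall i j, 0 <= (M *m N) i j.
Proof. by move=> M0 N0 i j; rewrite mxE; apply: sumr_ge0 => k _; rewrite mulr_ge0. Qed.

Lemma expmx_ge0 p (M : 'M[R]_p) m :
  (forall i j, 0 <= M i j) -> forall i j, 0 <= (M ^+ m) i j.
Proof.
move=> M0; elim: m => [|m IH] i j; first by rewrite expr0 mxE; case: eqP.
by rewrite exprS; apply: mulmx_ge0.
Qed.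

(** Induction on [m] by [branching_step]. The shift [r + 3] makes a descending walk available at
    every level; steps leaving the window are dropped, which only lowers the left side. *)
Lemma level_comparison (o w : T) (L m : nat) (phi : 'cV[R]_L) (G : T -> R)
    (B := level_mx L (fun i => delta (r - i))) :
  w != o -> (forall u, 0 <= G u) -> (forall l, 0 <= phi l 0) ->
  (forall (l : 'I_L) u, (d o u <= r + 3 + l)%N -> phi l 0 <= G u) ->
  forall (k : 'I_L) u, (d o u <= r + 3 + k)%N -> (B ^+ m *m phi) k 0 <= iter m distpow_op G u.
Proof.
move=> wo G0 phi0 phiG.
have B0 k l : 0 <= B k l by apply: level_mx_ge0.
elim: m => [|m IH] k u ok; first by rewrite expr0 mul1mx phiG.
rewrite exprS -mulmxA; set psi := B ^+ m *m phi in IH *.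
have psi0 l : 0 <= psi l 0.
  by apply: mulmx_ge0 => [i j|i j]; rewrite ?ord1 ?phi0 //; apply: expmx_ge0.
(* This is [psi] at the single level [k + r - 2i], or 0 if that level is outside the window. *)
pose W (i : nat) := \sum_(l < L) (l + i == k + (r - i))%N%:R * psi l 0.
have -> : (B *m psi) k 0 = \sum_(i < r.+1) delta (r - i) * W i.
  rewrite mxE; under eq_bigr do rewrite mxE mulr_suml.
  rewrite exchange_big; apply: eq_bigr => i _; rewrite mulr_sumr.
  by apply: eq_bigr => l _; rewrite mulrA [delta _ * _]mulrC.
apply: (branching_step (w := w) (k := r + 3 + k)) ok _ _ _ => // [|i|i|i t ir ot].
- by rewrite leq_addr.
- exact: iter_distpow_op_ge0.
- by apply: sumr_ge0 => l _; rewrite mulr_ge0.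
have [l /eqP le|nol] := pickP (fun l : 'I_L => l + i == k + (r - i))%N.
  rewrite /W (bigD1 l) //= le eqxx mul1r big1 => [|j ne].
    by rewrite addr0; apply: IH; lia.
  case: eqP => [e|]; last by rewrite mul0r.
  by case/eqP: ne; apply: val_inj; move: e le => /=; lia.
rewrite /W big1 => [|l _]; last by rewrite nol mul0r.
exact: iter_distpow_op_ge0.
Qed.

End LevelComparison.

(** * Symmetrising the level matrix by an entrywise geometric mean *)

Section GeometricMeanMatrix.
Variable R : realType.

(** Cauchy-Schwarz with the square roots cleared. *)
Lemma sqr_sum_le (I : finType) (P : pred I) (h b c : I -> R) :
  (forall i, 0 <= h i) -> (forall i, 0 <= b i) -> (forall i, 0 <= c i) ->
  (forall i, h i ^+ 2 <= b i * c i) ->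
  (\sum_(i | P i) h i) ^+ 2 <= (\sum_(i | P i) b i) * (\sum_(i | P i) c i).
Proof.
move=> h0 b0 c0 hbc.
pose K x y z := [/\ 0 <= x :> R, 0 <= y :> R, 0 <= z :> R & x ^+ 2 <= y * z].
suff [] : K (\sum_(i | P i) h i) (\sum_(i | P i) b i) (\sum_(i | P i) c i) by [].
elim/big_rec3: _ => [|i z y x _ [x0 y0 z0 xyz]].
  by split=> //; rewrite expr0n mulr0.
split; rewrite ?addr_ge0 //.
have hi0 := h0 i; have bi0 := b0 i; have ci0 := c0 i; have hi := hbc i.
(* This is AM-GM, since [(h i * x) ^+ 2] is at most the product of [b i * z] and [y * c i]. *)
suff : 2 * (h i * x) <= b i * z + y * c i by nra.
rewrite -(ler_pXn2r (n := 2)) ?nnegrE ?addr_ge0 ?mulr_ge0 //.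
have : h i ^+ 2 * x ^+ 2 <= (b i * c i) * (y * z) by apply: ler_pM; rewrite ?sqr_ge0.
have := sqr_ge0 (b i * z - y * c i).
nra.
Qed.

Lemma expmx_geometric_mean n (H B C : 'M[R]_n) m :
  (forall k l, 0 <= H k l) -> (forall k l, 0 <= B k l) -> (forall k l, 0 <= C k l) ->
  (forall k l, H k l ^+ 2 <= B k l * C k l) ->
  forall k l, (H ^+ m) k l ^+ 2 <= (B ^+ m) k l * (C ^+ m) k l.
Proof.
move=> H0 B0 C0 HBC; elim: m => [|m IH] k l.
  by rewrite !expr0 !mxE; case: eqP => _ /=; rewrite ?mulr1n ?mulr0n ?expr1n ?expr0n ?mulr1 ?mulr0.
rewrite !(exprS _ m) !mxE; apply: sqr_sum_le => j; rewrite ?mulr_ge0 ?expmx_ge0 //.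
rewrite exprMn [X in _ <= X](_ : _ = (B k j * C k j) * ((B ^+ m) j l * (C ^+ m) j l)); last by ring.
by apply: ler_pM; rewrite ?sqr_ge0.
Qed.

Variables (r L : nat).

Lemma level_mx_tr (a : nat -> R) :
  (level_mx r L a)^T = level_mx r L (fun i => a (r - i)%N).
Proof.
apply/matrixP=> k l; rewrite !mxE (reindex_inj rev_ord_inj) /=.
apply: eq_bigr => i _; rewrite subSS; have ir : (i <= r)%N by rewrite -ltnS.
by rewrite subKn // eq_sym.
Qed.

(** Transposition reverses the coefficients, so the second factor is an entry of the power for
    [D i], and the entrywise inequality for [m = 1] propagates to powers. *)
Lemma level_mx_geometric_mean (D : nat -> R) : (forall i, 0 <= D i) -> forall m k l,
  (level_mx r L (fun i => Num.sqrt (D i * D (r - i)%N)) ^+ m) k l ^+ 2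
    <= (level_mx r L (fun i => D (r - i)%N) ^+ m) k l
       * (level_mx r L (fun i => D (r - i)%N) ^+ m) l k.
Proof.
move=> D0 m k l.
have -> : (level_mx r L (fun i => D (r - i)%N) ^+ m) l k = (level_mx r L D ^+ m) k l.
  rewrite -level_mx_tr; set M := level_mx _ _ _.
  have -> : M^T ^+ m = (M ^+ m)^T; last by rewrite mxE.
  elim: m => [|m IH]; first by rewrite !expr0 trmx1.
  by rewrite exprS IH exprSr trmx_mul.
apply: expmx_geometric_mean => {k l} k l; try by rewrite level_mx_ge0.
  by apply: level_mx_ge0 => i; exact: sqrtr_ge0.
rewrite !mxE; apply: sqr_sum_le => i; rewrite ?mulr_ge0 ?sqrtr_ge0 //.
rewrite exprMn sqr_sqrtr ?mulr_ge0 //.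
by case: eqP => _; rewrite /= ?mulr1n ?mulr0n ?expr1n ?expr0n /= ?mul1r ?mul0r // mulrC.
Qed.

(** From a level at least [m * r] away from both ends, [m] steps of length at most [r] stay inside
    the window, so no mass is lost. *)
Lemma level_mx_row_sum (a : nat -> R) m (k : 'I_L) : (forall i, 0 <= a i) ->
  (m * r <= k)%N -> (k + m * r < L)%N ->
  (\sum_(i < r.+1) a i) ^+ m <= \sum_l (level_mx r L a ^+ m) k l.
Proof.
move=> a0; elim: m k => [|m IH] k km kL.
  rewrite !expr0 (bigD1 k) //= mxE eqxx mulr1n lerDl; apply: sumr_ge0 => l _.
  by rewrite mxE; case: eqP.
have H0 p q s : 0 <= (level_mx r L a ^+ s) p q by apply/expmx_ge0=> *; apply: level_mx_ge0.
rewrite !exprS; under [X in _ <= X]eq_bigr do rewrite mxE.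
rewrite exchange_big /=.
under [X in _ <= X]eq_bigr do rewrite -mulr_sumr mxE mulr_suml.
rewrite exchange_big mulr_suml; apply: ler_sum => i _.
have ir : (i <= r)%N by rewrite -ltnS.
have lL : (k + (r - i) - i < L)%N by lia.
rewrite (bigD1 (Ordinal lL)) //= subnK; last by lia.
rewrite eqxx mul1r -[X in X <= _]addr0; apply: lerD; last first.
  by apply: sumr_ge0 => j _; rewrite !mulr_ge0 ?sumr_ge0.
by rewrite ler_wpM2l // IH //=; lia.
Qed.

End GeometricMeanMatrix.

(** Only the [2 * (m * r)] rows in the middle half of the window are counted; the others are bounded
    below by 0. *)
Lemma level_mx_sum (R : realType) (r m : nat) (a : nat -> R) :
  (forall i, 0 <= a i) ->
  (2 * (m * r))%:R * (\sum_(i < r.+1) a i) ^+ m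
    <= \sum_k \sum_l (level_mx r (4 * (m * r)) a ^+ m) k l.
Proof.
move=> a0; set M := (m * r)%N; set x := _ ^+ m.
pose f (k : nat) : R := if (M <= k < 3 * M)%N then x else 0.
have x0 : 0 <= x by rewrite exprn_ge0 ?sumr_ge0.
apply: (@le_trans _ _ (\sum_(k < 4 * M) f k)); last first.
  apply: ler_sum => k _; rewrite /f; case: ifP => [/andP[k1 k2]|_].
    by apply: level_mx_row_sum; rewrite // -/M; lia.
  by apply: sumr_ge0 => l _; apply/expmx_ge0=> *; apply: level_mx_ge0.
rewrite -(big_mkord xpredT f) (big_cat_nat (n := M)) //=; last by lia.
rewrite (big_cat_nat (n := (3 * M)%N) (m := M)) /=; try lia.
have -> : \sum_(M <= i < 3 * M) f i = (2 * M)%:R * x.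
  rewrite (eq_big_nat _ _ (F2 := fun=> x)); last by move=> i Mi; rewrite /f Mi.
  by rewrite sumr_const_nat mulr_natl; congr (_ *+ _); lia.
have f0 p q : 0 <= \sum_(p <= i < q) f i.
  by apply: sumr_ge0 => i _; rewrite /f; case: ifP.
have := f0 0%N M; have := f0 (3 * M)%N (4 * M)%N; lra.
Qed.

(** * A test function built from nearly orthogonal balls *)

Lemma geometric_sum_le (R : realType) (b M : nat) :
  \sum_(c < M) (2^-1 : R) ^+ ((c - b) + (b - c)) <= 3.
Proof.
have h0 n : 0 <= (2^-1 : R) ^+ n by rewrite exprn_ge0 ?invr_ge0.
(* A bound on every partial sum makes the induction work: one geometric series up to [b], then a
   second one beyond it. *)
suff : \sum_(c < M) (2^-1 : R) ^+ ((c - b) + (b - c))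
    <= if (M <= b)%N then 2^-1 ^+ (b - M) else 3 - 2 * 2^-1 ^+ (M - b).
  have h1 n : (2^-1 : R) ^+ n <= 1 by rewrite exprn_ile1 ?invr_ge0 ?invf_le1 ?ler1n.
  by case: ifP => _; [have := h1 (b - M)%N|have := h0 (M - b)%N]; lra.
elim: M => [|M IH]; first by rewrite big_ord0 h0.
rewrite big_ord_recr /=; apply: le_trans (lerD IH (lexx _)) _.
case: (ltngtP M b) => [lt|lt|->].
- rewrite (_ : (M - b + (b - M) = b - M)%N); last by lia.
  rewrite (_ : (b - M = (b - M.+1).+1)%N); last by lia.
  by rewrite exprS; lra.
- rewrite (_ : (M - b + (b - M) = M - b)%N); last by lia.
  by rewrite subSn ?(ltnW lt) // exprS; lra.
by rewrite subnn subSnn addn0 expr0 expr1; lra.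
Qed.

Section TestFunction.
Variables (R : realType) (T : finType) (adj : rel T) (r L : nat) (o : T).
Hypotheses (simple : simple_graph adj) (conn : connected_graph adj).
Local Notation d := (dist adj).
Local Notation op := (@distpow_op R T adj r).

Lemma iter_distpow_op_sum (I : finType) (c : I -> R) (G : I -> T -> R) j u :
  iter j op (fun v => \sum_b c b * G b v) u = \sum_b c b * iter j op (G b) u.
Proof.
elim: j u => [//|j IH] u; rewrite iterS [LHS](eq_bigr _ (fun v _ => IH v)).
by rewrite exchange_big; apply: eq_bigr => b _; rewrite mulr_sumr.
Qed.

Lemma distpow_op_adj (F G : T -> R) : \sum_v F v * op G v = \sum_v op F v * G v.
Proof.
rewrite /distpow_op; under eq_bigr do rewrite mulr_sumr.
under [RHS]eq_bigr do rewrite mulr_suml.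
rewrite (exchange_big_dep xpredT) //=; apply: eq_bigr => v _.
by apply: eq_bigl => u; rewrite dist_sym.
Qed.

Lemma iter_distpow_op_adj j (F G : T -> R) :
  \sum_v F v * iter j op G v = \sum_v iter j op F v * G v.
Proof.
elim: j F => [//|j IH] F; rewrite [in LHS]iterS distpow_op_adj IH.
by rewrite -iterSr.
Qed.

Definition ball_set (k : nat) : {set T} := [set v | (d o v <= r + 3 + k)%N].

(* The levels are grouped into blocks on which the ball size varies by a factor
   less than 4, so that the normalised indicators of distinct blocks are almost
   orthogonal. *)
Definition block (k : nat) : 'I_#|T|.+1 := inord (trunc_log 4 #|ball_set k|).

Lemma block_bounds k : (4 ^ block k <= #|ball_set k| < 4 ^ (block k).+1)%N.
Proof.
have N0 : (0 < #|ball_set k|)%N.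
  by apply/card_gt0P; exists o; rewrite inE distxx.
have /andP[lo hi] := trunc_log_bounds (isT : 1 < 4)%N N0.
(* [inord] does not overflow: the logarithm is less than its power of 4, which is at most [#|T|]. *)
rewrite /block inordK ?lo ?hi //.
rewrite ltnS; apply: leq_trans (max_card (ball_set k)); apply: leq_trans lo.
exact/ltnW/ltn_expl.
Qed.

Definition block_ball (b : 'I_#|T|.+1) : {set T} :=
  [set v | [exists k : 'I_L, (block k == b) && (v \in ball_set k)]].

(** The balls are nested, so the union over a nonempty block is the ball of its largest level. *)
Lemma card_block_ball b : (#|block_ball b| <= 4 ^ b.+1)%N.
Proof.
have [k0 /eqP k0b|nok] := pickP (fun k : 'I_L => block k == b); last first.
  rewrite (_ : block_ball b = set0) ?cards0 //.
  by apply/setP=> v; rewrite !inE; apply/existsP=> -[k]; rewrite nok.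
case: (@arg_maxnP _ k0 (fun k : 'I_L => block k == b) (fun k => k : nat)).
  exact/eqP.
move=> k /eqP kb kmax; apply: leq_trans (_ : #|ball_set k| <= _)%N.
  apply/subset_leq_card/subsetP => v; rewrite inE => /existsP[j /andP[jb]].
  by rewrite !inE => /leq_trans; apply; rewrite leq_add2l; apply: kmax.
by rewrite -kb; case/andP: (block_bounds k) => _ /ltnW.
Qed.

Definition block_size (b : 'I_#|T|.+1) : nat := #|[pred k : 'I_L | block k == b]|.

(** [2 ^+ b] approximates the square root of the ball size, so a block contributes at most four
    times its number of levels to the diagonal part of the squared norm. *)
Definition block_weight b : R := Num.sqrt (block_size b)%:R / 2 ^+ b.

Definition test_fun (v : T) : R :=
  \sum_b block_weight b * (v \in block_ball b)%:R.

Lemma block_weight_ge0 b : 0 <= block_weight b.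
Proof. by rewrite divr_ge0 ?sqrtr_ge0 ?exprn_ge0. Qed.

Lemma sum_block_size : (\sum_b block_size b)%N = L.
Proof.
rewrite -[RHS]card_ord -[RHS]sum1_card (partition_big (fun k : 'I_L => block k) xpredT) //=.
by apply: eq_bigr => b _; rewrite sum1_card.
Qed.

(** For [b <= c] the powers combine to 4 times [2^-1 ^+ (c - b)], and AM-GM bounds the product of
    the two square roots. *)
Lemma block_weight_mul b c :
  block_weight b * block_weight c * (4 ^ (minn b c).+1)%:R
    <= 2 * ((block_size b)%:R + (block_size c)%:R) * 2^-1 ^+ ((c - b) + (b - c)) :> R.
Proof.
wlog le_bc : b c / (b <= c)%N => [wl|].
  case/orP: (leq_total b c) => [/wl //|cb]; have := wl _ _ cb.
  rewrite (minnC c) (addnC (b - c)%N) (addrC (block_size c)%:R).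
  by rewrite (mulrC (block_weight c)).
rewrite (minn_idPl le_bc) (_ : (b - c = 0)%N) ?addn0; last by apply/eqP.
rewrite /block_weight; set x : R := (block_size b)%:R; set y : R := (block_size c)%:R.
have x0 : 0 <= x by [].
have y0 : 0 <= y by [].
have -> : Num.sqrt x / 2 ^+ b * (Num.sqrt y / 2 ^+ c) * (4 ^ b.+1)%:R
    = 4 * (Num.sqrt x * Num.sqrt y) * 2^-1 ^+ (c - b).
  rewrite natrX exprS (_ : 4%:R ^+ b = (2 ^+ b) * (2 ^+ b) :> R); last first.
    by rewrite -exprMn; congr (_ ^+ _); ring.
  rewrite -{1}(subnK le_bc) exprD exprVn; field.
  have n2 n : (2 : R) ^+ n != 0 by rewrite expf_neq0 // pnatr_eq0.
  by rewrite ?n2 ?pnatr_eq0.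
rewrite ler_wpM2r ?exprn_ge0 ?invr_ge0 //.
have := sqr_ge0 (Num.sqrt x - Num.sqrt y).
have := sqr_sqrtr x0; have := sqr_sqrtr y0; nra.
Qed.

(** An intersection of two block balls is no larger than the smaller bound, so the cross terms decay
    geometrically. The constant 12 is two symmetric halves, times 2 from [block_weight_mul], times 3
    from the series. *)
Lemma test_fun_norm : \sum_v test_fun v ^+ 2 <= (12 * L)%:R.
Proof.
have -> : \sum_v test_fun v ^+ 2 = \sum_b \sum_c block_weight b * block_weight c
    * (#|block_ball b :&: block_ball c|)%:R.
  under eq_bigr do rewrite expr2 /test_fun mulr_suml.
  rewrite exchange_big; apply: eq_bigr => b _ /=.
  under eq_bigr do rewrite mulr_sumr.
  rewrite exchange_big; apply: eq_bigr => c _ /=.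
  rewrite -sum1_card natr_sum [in RHS]big_mkcond [RHS]mulr_sumr; apply: eq_bigr => v _.
  rewrite [X in if X then _ else _]inE; case: (v \in block_ball b); case: (v \in block_ball c);
    by rewrite /= !(mulr1, mulr0, mul0r).
apply: (@le_trans _ _ (\sum_b \sum_c 2 * ((block_size b)%:R + (block_size c)%:R)
     * 2^-1 ^+ ((c - b) + (b - c)))).
  apply: ler_sum => b _; apply: ler_sum => c _; apply: le_trans (block_weight_mul b c).
  apply: ler_wpM2l; first by rewrite mulr_ge0 ?block_weight_ge0.
  rewrite ler_nat.
  case: (leqP b c) => [le|lt].
    exact: leq_trans (subset_leq_card (subsetIl _ _)) (card_block_ball b).
  exact: leq_trans (subset_leq_card (subsetIr _ _)) (card_block_ball c).
have half : \sum_b \sum_(c < #|T|.+1)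
    2 * (block_size b)%:R * 2^-1 ^+ ((c - b) + (b - c)) <= (6 * L)%:R :> R.
  rewrite -sum_block_size big_distrr natr_sum /=; apply: ler_sum => b _.
  rewrite -mulr_sumr natrM; have := geometric_sum_le R b #|T|.+1.
  by move: (\sum_(i < _) _) => g; have : 0 <= (block_size b)%:R :> R by []; nra.
rewrite (_ : (12 * L = 6 * L + 6 * L)%N); last by lia.
rewrite natrD; apply: le_trans (lerD half half).
under eq_bigr do under eq_bigr do rewrite mulrDr mulrDl.
under eq_bigr do rewrite big_split.
rewrite big_split lerD2l /= exchange_big.
by apply: ler_sum => b _; apply: ler_sum => c _; rewrite addnC.
Qed.

Lemma test_fun_support v : test_fun v != 0 -> (d o v < r + 3 + L)%N.
Proof.
apply: contraR; rewrite -leqNgt => Lv; apply/eqP; apply: big1 => b _.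
case: (boolP (v \in _)) => [|_]; last by rewrite mulr0.
rewrite inE => /existsP[k /andP[_]]; rewrite inE => vk.
by have := ltn_ord k; lia.
Qed.

Variables (m : nat) (w : T).
Hypothesis wo : w != o.
Local Notation delta i := ((delta_i adj i)%:R : R).
Local Notation B := (level_mx r L (fun i => delta (r - i))).
Local Notation H := (level_mx r L (fun i => Num.sqrt (delta i * delta (r - i)))).
Local Notation ind b := (fun v : T => (v \in block_ball b)%:R : R).

Definition block_form b c : R := \sum_v ind b v * iter m op (ind c) v.

Lemma block_form_sym b c : block_form b c = block_form c b.
Proof.
by rewrite /block_form iter_distpow_op_adj; apply: eq_bigr => v _; rewrite mulrC.
Qed.

Lemma block_form_ge0 b c : 0 <= block_form b c.
Proof.
by apply: sumr_ge0 => v _; rewrite mulr_ge0 // iter_distpow_op_ge0.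
Qed.

(** For each level [k] of block [b], the comparison from the indicator of block [c] holds on all of
    [ball_set k], which has at least [4 ^ b] vertices; summing over [k] gives the factor
    [block_size b]. *)
Lemma block_form_ge (b c : 'I_#|T|.+1) :
  4 ^+ b * (\sum_(k < L | block k == b) \sum_(l < L | block l == c) (B ^+ m) k l)
    <= (block_size b)%:R * block_form b c.
Proof.
rewrite mulr_sumr /block_size mulr_natl -sumr_const; apply: ler_sum => k kb.
pose phi : 'cV[R]_L := \col_l (block l == c)%:R.
have -> : \sum_(l < L | block l == c) (B ^+ m) k l = (B ^+ m *m phi) k 0.
  rewrite mxE big_mkcond; apply: eq_bigr => l _; rewrite mxE.
  by case: eqP; rewrite ?mulr1 ?mulr0.
have B0 : 0 <= (B ^+ m *m phi) k 0.
  apply: mulmx_ge0 => [i j|i j]; last by rewrite mxE.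
  by apply/expmx_ge0=> *; apply: level_mx_ge0.
have pt u : u \in ball_set k -> (B ^+ m *m phi) k 0 <= iter m op (ind c) u.
  rewrite inE => ou; apply: (@level_comparison R T adj r simple conn o w L m phi _ wo) ou => [t|l|l t ot] //.
    by rewrite mxE.
  rewrite mxE; case: (boolP (block l == c)) => [lc|//].
  rewrite (_ : t \in _) // inE; apply/existsP; exists l; rewrite lc inE ot //.
apply: (@le_trans _ _ (#|ball_set k|%:R * (B ^+ m *m phi) k 0)).
  apply: ler_wpM2r => //; rewrite -natrX ler_nat -(eqP kb).
  by case/andP: (block_bounds k).
rewrite mulr_natl -sumr_const big_mkcond; apply: ler_sum => v _ /=.
case: ifP => vk; last by rewrite mulr_ge0 // iter_distpow_op_ge0.
rewrite (_ : v \in block_ball b) ?mul1r ?pt // inE.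
by apply/existsP; exists k; rewrite kb vk.
Qed.

(** Cauchy-Schwarz bounds the square of the left side by the block sum of [B ^+ m] times that of its
    transpose. [block_form_ge] bounds these by the same symmetric form, and
    [4 ^+ b * block_weight b ^+ 2] is exactly [block_size b]. *)
Lemma block_form_geometric_mean (b c : 'I_#|T|.+1) :
  \sum_(k < L | block k == b) \sum_(l < L | block l == c) (H ^+ m) k l
    <= block_weight b * block_weight c * block_form b c.
Proof.
have B0 k l : 0 <= (B ^+ m) k l by apply/expmx_ge0=> *; apply: level_mx_ge0.
have H0 k l : 0 <= (H ^+ m) k l.
  by apply/expmx_ge0=> *; apply: level_mx_ge0 => i; apply: sqrtr_ge0.
have Z0 : 0 <= \sum_(k < L | block k == b) \sum_(l < L | block l == c) (H ^+ m) k l.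
  by apply: sumr_ge0 => k _; apply: sumr_ge0.
have W0 : 0 <= block_weight b * block_weight c * block_form b c.
  apply: mulr_ge0 (block_form_ge0 b c).
  exact: mulr_ge0 (block_weight_ge0 b) (block_weight_ge0 c).
rewrite -(ler_pXn2r (n := 2)) ?nnegrE //.
have le1 := block_form_ge b c; have le2 := block_form_ge c b.
rewrite block_form_sym exchange_big /= in le2.
set X := \sum_(k < L | _) _ in le1; set Y := \sum_(k < L | _) _ in le2.
apply: (@le_trans _ _ (X * Y)).
  apply: sqr_sum_le => k; try by apply: sumr_ge0.
  apply: sqr_sum_le => l //.
  by apply: (@level_mx_geometric_mean R r L (fun i => delta i)).
have X0 : 0 <= X by apply: sumr_ge0 => k _; apply: sumr_ge0.
have Y0 : 0 <= Y by apply: sumr_ge0 => k _; apply: sumr_ge0.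
have pw n : 0 < (4 : R) ^+ n by rewrite exprn_gt0.
have le12 : (4 ^+ b * X) * (4 ^+ c * Y) <=
    ((block_size b)%:R * block_form b c) * ((block_size c)%:R * block_form b c).
  by apply: ler_pM => //; rewrite mulr_ge0 // ltW.
rewrite -(ler_pM2l (mulr_gt0 (pw b) (pw c))) mulrACA; apply: le_trans le12 _.
have wE (a : 'I_#|T|.+1) : 4 ^+ a * block_weight a ^+ 2 = (block_size a)%:R.
  rewrite /block_weight exprMn sqr_sqrtr // exprVn -exprM mulnC exprM.
  rewrite (_ : 2 ^+ 2 = 4 :> R); last by ring.
  by rewrite mulrC divfK // gt_eqF.
rewrite -!wE; set x := block_form b c; nra.
Qed.

Lemma test_fun_form :
  \sum_k \sum_l (H ^+ m) k l <= \sum_v test_fun v * iter m op test_fun v.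
Proof.
have -> : \sum_v test_fun v * iter m op test_fun v
    = \sum_b \sum_c block_weight b * block_weight c * block_form b c.
  under eq_bigr do rewrite /test_fun iter_distpow_op_sum mulr_suml.
  rewrite exchange_big; apply: eq_bigr => b _ /=.
  under eq_bigr do rewrite mulr_sumr.
  rewrite exchange_big; apply: eq_bigr => c _ /=.
  by rewrite mulr_sumr; apply: eq_bigr => v _; ring.
rewrite (partition_big (fun k : 'I_L => block k) xpredT) //=.
apply: ler_sum => b _.
under eq_bigr => k _ do rewrite (partition_big (fun l : 'I_L => block l) xpredT) //=.
rewrite exchange_big; apply: ler_sum => c _.
exact: block_form_geometric_mean.
Qed.

End TestFunction.

(** * From a pair of test functions to the second eigenvalue *)

Lemma bilinear_form_comb (R : comPzRingType) n (M : 'M[R]_n) (f g : 'rV[R]_n) (a b : R) :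
  ((a *: f + b *: g) *m M *m (a *: f + b *: g)^T) 0 0
    = a ^+ 2 * (f *m M *m f^T) 0 0 + a * b * (f *m M *m g^T) 0 0
      + a * b * (g *m M *m f^T) 0 0 + b ^+ 2 * (g *m M *m g^T) 0 0.
Proof.
rewrite linearD !linearZ /= !mulmxDl !mulmxDr -!scalemxAl -!scalemxAr.
move: (f *m M *m f^T) (f *m M *m g^T) (g *m M *m f^T) (g *m M *m g^T) => X Y Z W.
by rewrite !mxE; ring.
Qed.

(** Both forms are diagonal on the span of [f] and [g], so the bounds add up; positivity of the
    [A ^+ m] form yields linear independence. *)
Lemma lambda2_orthogonal_pair (R : realType) n (A : 'M[R]_n) (l mu : R) m (f g : 'rV[R]_n)
    (q := fun M (x y : 'rV[R]_n) => (x *m M *m y^T) 0 0) :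
  A^T = A -> is_lambda2 A l -> odd m ->
  q 1%:M f g = 0 -> q (A ^+ m) f g = 0 ->
  mu * q 1%:M f f <= q (A ^+ m) f f -> mu * q 1%:M g g <= q (A ^+ m) g g ->
  0 < q (A ^+ m) f f -> 0 < q (A ^+ m) g g -> mu <= l ^+ m.
Proof.
move=> symA lA om fg0 fAg0 lef leg posf posg.
have q_sym M x y : M^T = M -> q M x y = q M y x.
  move=> symM; transitivity ((y *m M *m x^T)^T 0 0); last by rewrite [LHS]mxE.
  by rewrite /q !trmx_mul trmxK symM mulmxA.
have gf0 : q 1%:M g f = 0 by rewrite q_sym ?trmx1.
have gAf0 : q (A ^+ m) g f = 0 by rewrite q_sym ?expmx_sym.
apply: (lambda2_minmax (f := f) (g := g) symA lA om) => a b.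
  rewrite /q in fg0 fAg0 gf0 gAf0 lef leg.
  rewrite -[X in X *m _^T]mulmx1 !bilinear_form_comb.
  rewrite fg0 fAg0 gf0 gAf0 !mulr0 !addr0.
  have := sqr_ge0 a; have := sqr_ge0 b; nra.
move=> ab0; have E x : q (A ^+ m) (a *: f + b *: g) x = 0 by rewrite ab0 /q !mul0mx mxE.
have Q x : q (A ^+ m) (a *: f + b *: g) x = a * q (A ^+ m) f x + b * q (A ^+ m) g x.
  rewrite /q !mulmxDl -!scalemxAl; move: (f *m _ *m _) (g *m _ *m _) => X Y.
  by rewrite !mxE.
split.
  have /eqP := E f; rewrite Q gAf0 mulr0 addr0 mulf_eq0 (gt_eqF posf) orbF.
  by move/eqP.
have /eqP := E g; rewrite Q fAg0 mulr0 add0r mulf_eq0 (gt_eqF posg) orbF.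
by move/eqP.
Qed.

(** The principal minor on [i] and [j] is positive semidefinite, so the case [m = 1], [mu = 0] of
    [lambda2_minmax] applies. The sign is needed for extracting [m]-th roots. *)
Lemma lambda2_ge0 (R : realType) n (A : 'M[R]_n) (l : R) (i j : 'I_n) :
  A^T = A -> is_lambda2 A l -> i != j -> A i i = 1 -> A j j = 1 -> 0 <= A i j <= 1 ->
  0 <= l.
Proof.
move=> symA lA ij Aii Ajj /andP[Aij0 Aij1].
rewrite -[l]expr1; apply: (lambda2_minmax (f := delta_mx 0 i) (g := delta_mx 0 j) symA lA) => // a b.
  have E p q : ((delta_mx 0 p : 'rV[R]_n) *m A *m (delta_mx 0 q : 'rV[R]_n)^T) 0 0 = A p q.
    by rewrite -rowE trmx_delta -colE !mxE.
  have Aji : A j i = A i j by rewrite -[in RHS]symA mxE.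
  rewrite mul0r expr1 bilinear_form_comb !E Aii Ajj Aji.
  have := sqr_ge0 (a + b); have := sqr_ge0 (a - b); nra.
move=> /rowP ab0; have := ab0 i; have := ab0 j.
rewrite !mxE !eqxx (negPf ij) [j == i]eq_sym (negPf ij) /= !mulr0 !mulr1 addr0 add0r.
by [].
Qed.

(** For [t < 1], [(1 - t) ^+ m] is at most the inverse of [(1 + t) ^+ m], which Bernoulli bounds by
    1/24 as [t * m] is at least 23. *)
Lemma bernoulli_root (R : realType) (S l t : R) m :
  0 <= S -> 0 <= l -> (0 < m)%N -> 0 <= t -> 23 <= t * m%:R ->
  S ^+ m <= 24 * l ^+ m -> (1 - t) * S <= l.
Proof.
move=> S0 l0 m0 t0 tm le; have [t1|t1] := leP 1 t; first by nra.
rewrite leNgt; apply/negP => lt.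
have Sp : 0 < S by rewrite lt_neqAle S0 andbT; apply/eqP => e; rewrite -e in lt; lra.
have lt2 : l ^+ m < ((1 - t) * S) ^+ m by rewrite ltrXn2r // -lt0n.
have Sm : 0 < S ^+ m by rewrite exprn_gt0.
have ber j : 1 + t * j%:R <= (1 + t) ^+ j.
  elim: j => [|j IH]; first by rewrite mulr0 addr0 expr0.
  rewrite exprS -natr1; have : 0 <= j%:R :> R by []. nra.
have le1 : (1 - t) ^+ m * (1 + t) ^+ m <= 1.
  by rewrite -exprMn exprn_ile1 //; nra.
have p0 : 0 <= (1 - t) ^+ m by rewrite exprn_ge0 //; lra.
have le24 : 24 * (1 - t) ^+ m <= 1 by have := ber m; nra.
rewrite exprMn in lt2; nra.
Qed.

(** * The bound for a single graph *)

Section DistancePower.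
Variables (R : realType) (T : finType) (adj : rel T) (r : nat).
Hypotheses (simple : simple_graph adj) (conn : connected_graph adj).
Local Notation d := (dist adj).
Local Notation delta i := ((delta_i adj i)%:R : R).
Local Notation op := (@distpow_op R T adj r).
Local Notation A := (distpow_mx R adj r).

Definition vertex_row (F : T -> R) : 'rV[R]_#|T| := \row_j F (enum_val j).

Lemma vertex_row_dot (F G : T -> R) :
  (vertex_row F *m (vertex_row G)^T) 0 0 = \sum_v F v * G v.
Proof.
rewrite mxE [RHS](reindex (@enum_val T T)) /=; last exact/onW_bij/enum_val_bij.
by apply: eq_bigr => j _; rewrite !mxE.
Qed.

Lemma vertex_row_distpow F m : vertex_row F *m A ^+ m = vertex_row (iter m op F).
Proof.
elim: m => [|m IH]; first by rewrite expr0 mulmx1.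
rewrite exprSr mulmxA IH; apply/rowP=> j; rewrite !mxE iterS {2}/distpow_op.
rewrite [RHS]big_mkcond [RHS](reindex (@enum_val T T)) /=; last exact/onW_bij/enum_val_bij.
apply: eq_bigr => i _; rewrite !mxE dist_sym //.
by case: ifP; rewrite ?mulr1 ?mulr0.
Qed.

Lemma distpow_mx_sym : A^T = A.
Proof. by apply/matrixP=> i j; rewrite !mxE dist_sym. Qed.

Lemma iter_distpow_op_support o c j F :
  (forall v, F v != 0 -> (d o v < c)%N) ->
  forall v, iter j op F v != 0 -> (d o v < c + j * r)%N.
Proof.
move=> Fc; elim: j => [|j IH] v /=; first by rewrite addn0; apply: Fc.
apply: contraR => ov; rewrite /distpow_op big1 // => u vu.
apply/eqP; apply: contraR ov => /IH ou.
have := dist_triangle conn o u v; rewrite (dist_sym simple conn u); lia.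
Qed.

Lemma lambda2_distpow_ge0 (x y : T) l : x != y -> is_lambda2 A l -> 0 <= l.
Proof.
move=> xy lA; apply: (@lambda2_ge0 _ _ _ _ (enum_rank x) (enum_rank y)) lA _ _ _ _.
- exact: distpow_mx_sym.
- by apply: contra xy => /eqP/enum_rank_inj/eqP.
- by rewrite mxE distxx.
- by rewrite mxE distxx.
by rewrite mxE; case: (_ <= r)%N; rewrite ?lexx ?ler01.
Qed.

(** Each test function lives within [r + 3 + 4mr] of its centre and [A ^+ m] spreads it by [mr];
    twice the former plus the latter is [9mr + 2r + 6], at most [(9m + 8)r]. *)
Lemma lambda2_distpow_ge (x y : T) m l (S := \sum_(i < r.+1) Num.sqrt (delta i * delta (r - i))) :
  (0 < r)%N -> odd m -> ((9 * m + 8) * r < d x y)%N -> is_lambda2 A l ->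
  S ^+ m <= 24 * l ^+ m.
Proof.
move=> r0 om far lA.
have m0 : (0 < m)%N by case: m om {far}.
have xy : x != y by apply: contraTneq far => ->; rewrite distxx.
have l0 := lambda2_distpow_ge0 xy lA.
have S0 : 0 <= S by apply: sumr_ge0 => i _; apply: sqrtr_ge0.
have [/eqP Sz|Sn] := boolP (S == 0).
  by rewrite Sz expr0n gtn_eqF // mulr_ge0 // exprn_ge0.
have Sm : 0 < S ^+ m by rewrite exprn_gt0 // lt_neqAle eq_sym Sn.
pose L := (4 * (m * r))%N.
pose F z := test_fun R adj r L z.
have form z t : t != z ->
    (2 * (m * r))%:R * S ^+ m <= \sum_v F z v * iter m op (F z) v.
  move=> tz; apply: le_trans (test_fun_form R r L simple conn m tz).
  by apply: level_mx_sum => i; apply: sqrtr_ge0.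
have norm z : \sum_v F z v ^+ 2 <= (12 * L)%:R by apply: test_fun_norm.
(* Case [j = 0] gives orthogonality of the two functions, and [j = m] the vanishing of their cross
   form. *)
have supp j v : F x v * iter j op (F y) v = 0 \/ (m < j)%N.
  case: (leqP j m) => jm; [left|by right].
  apply/eqP; rewrite mulf_eq0; apply/norP=> -[xv yv].
  have := iter_distpow_op_support (@test_fun_support R T adj r L y) yv.
  have := test_fun_support xv; have := dist_triangle conn x v y.
  rewrite (dist_sym simple conn v) /L; have : (j * r <= m * r)%N by rewrite leq_mul2r jm orbT.
  lia.
have M0 : 0 < (2 * (m * r))%:R :> R by rewrite ltr0n !muln_gt0 m0 r0.
have mu_le z t : t != z -> S ^+ m / 24 * (\sum_v F z v * F z v)
    <= \sum_v F z v * iter m op (F z) v.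
  move=> tz; apply: le_trans (form z t tz); have := norm z.
  under eq_bigr do rewrite expr2.
  (* The constant 24 is the ratio of the norm bound [12 * L = 48mr] to the number [2mr] of full
     rows. *)
  rewrite (_ : (12 * L = 24 * (2 * (m * r)))%N); last by rewrite /L; lia.
  rewrite natrM; move: (\sum_v _) => N; nra.
suff : S ^+ m / 24 <= l ^+ m by lra.
apply: (lambda2_orthogonal_pair (f := vertex_row (F x)) (g := vertex_row (F y))
  distpow_mx_sym lA om); rewrite ?mulmx1 ?vertex_row_distpow ?vertex_row_dot.
- by apply: big1 => v _; case: (supp 0%N v).
- rewrite -iter_distpow_op_adj //.
  by apply: big1 => v _; case: (supp m v) => //; rewrite ltnn.
- under [X in _ <= X]eq_bigr do rewrite mulrC.
  by apply: (mu_le x y); rewrite eq_sym.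
- under [X in _ <= X]eq_bigr do rewrite mulrC.
  exact: (mu_le y x).
- under eq_bigr do rewrite mulrC.
  by apply: lt_le_trans (mulr_gt0 M0 Sm) (form x y _); rewrite eq_sym.
under eq_bigr do rewrite mulrC.
exact: lt_le_trans (mulr_gt0 M0 Sm) (form y x xy).
Qed.

Lemma ltn_diam c : (c < diam adj)%N -> exists x y, (c < d x y)%N.
Proof.
move=> lt; have [x /existsP[y xy]|no] := pickP (fun x => [exists y, c < d x y])%N.
  by exists x, y.
move: lt; rewrite ltnNge => /negP[]; apply/bigmax_leqP => x _; apply/bigmax_leqP => y _.
by rewrite leqNgt; apply/negP => xy; move: (no x) => /existsP[]; exists y.
Qed.

Lemma hat_d_powR : (0 < r)%N ->
  (r.+1)%:R * powR (hat_d R adj r) (r%:R / 2)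
    = \sum_(i < r.+1) Num.sqrt (delta i * delta (r - i)).
Proof.
move=> r0; rewrite /hat_d -powRrM.
rewrite (_ : 2 / r%:R * (r%:R / 2) = 1); last by field; rewrite pnatr_eq0 -lt0n.
rewrite powRr1; last by rewrite mulr_ge0 ?invr_ge0 // sumr_ge0 // => i _; apply: sqrtr_ge0.
by rewrite mulVKf ?pnatr_eq0 // big_mkord.
Qed.

Lemma lambda2_distpow_eps (eps l : R) :
  (0 < r)%N -> r%:R = eps * (diam adj)%:R -> is_lambda2 A l ->
  (1 - 1000 * eps) * \sum_(i < r.+1) Num.sqrt (delta i * delta (r - i)) <= l.
Proof.
move=> r0 rE lA; set S := \sum_(i < _) _.
have S0 : 0 <= S by apply: sumr_ge0 => i _; apply: sqrtr_ge0.
have D0 : (0 < diam adj)%N.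
  rewrite lt0n; apply/eqP => D0; have : 0 < r%:R :> R by rewrite ltr0n.
  by rewrite rE D0 mulr0 ltxx.
have l0 : 0 <= l.
  have [x [y xy]] := ltn_diam D0.
  apply: (@lambda2_distpow_ge0 x y) lA.
  by apply: contraTneq xy => ->; rewrite distxx.
have [big|small] := leP 1 (1000 * eps); first by nra.
have D0R : 0 < (diam adj)%:R :> R by rewrite ltr0n.
have eps0 : 0 <= eps.
  by have : 0 < r%:R :> R by [rewrite ltr0n]; rewrite rE pmulr_lgt0 // => /ltW.
have rD : (1000 * r < diam adj)%N.
  by rewrite -(ltr_nat R) natrM rE; nra.
(* The odd [m] is about [1 / (40 * eps)]: small enough for [(9m + 8)r] to stay below the diameter,
   large enough for [1000 * eps * m] to reach 23. [rD] forces [q] to be at least 12, which absorbs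
   the rounding. *)
pose q := (diam adj %/ (80 * r))%N; pose m := q.*2.+1.
have le_q : (80 * (q * r) <= diam adj)%N.
  by have := leq_divM (diam adj) (80 * r); rewrite -/q; lia.
have lt_q : (diam adj < 80 * (q * r) + 80 * r)%N.
  have := ltn_ceil (diam adj) (_ : 0 < 80 * r)%N; rewrite -/q muln_gt0 r0 => /(_ isT); lia.
have [x [y far]] : exists x y, ((9 * m + 8) * r < d x y)%N.
  by apply: ltn_diam; rewrite /m -muln2; lia.
apply: (@bernoulli_root _ _ _ _ m) => //.
- by rewrite mulr_ge0.
- rewrite -(ler_pM2r D0R) mulrAC -[1000 * eps * _]mulrA -rE -natrM -natrM.
  by rewrite -natrM ler_nat /m -muln2; lia.
have om : odd m by rewrite /m /= odd_double.
exact: (lambda2_distpow_ge r0 om far lA).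
Qed.

End DistancePower.

(** * The asymptotic form *)

Theorem theorem3 (R : realType) :
  exists c : R -> R,
    (forall eta : R, 0 < eta -> exists delta : R, 0 < delta /\
        forall eps : R, 0 < eps -> eps < delta -> `|c eps| < eta) /\
    forall eps : R, 0 < eps ->
    forall (V : nat -> finType) (adj : forall n, rel (V n)),
      (forall n, simple_graph (adj n)) ->
      (forall n, connected_graph (adj n)) ->
      (forall M : nat, exists N : nat, forall n, (N <= n)%N -> (M <= diam (adj n))%N) ->
    forall r : nat -> nat,
      (forall n, (0 < r n)%N) ->
      (forall n, (r n)%:R = eps * (diam (adj n))%:R :> R) ->
    forall eta : R, 0 < eta ->
    exists N : nat, forall n, (N <= n)%N ->
    forall l : R, is_lambda2 (distpow_mx R (adj n) (r n)) l ->
      (1 - c eps - eta) * ((r n).+1)%:R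
        * powR (hat_d R (adj n) (r n)) ((r n)%:R / 2) <= l.
Proof.
(* The error in the bound for one graph depends on [eps] alone, so it holds from [N = 0] on. *)
exists (fun eps => 1000 * eps); split=> [eta eta0|].
  exists (eta / 1000); split=> [|eps eps0 lt]; first by rewrite divr_gt0.
  by rewrite ger0_norm ?mulr_ge0 ?ltW //; lra.
move=> eps _ V adj simple conn _ r r0 rE eta eta0; exists 0%N => n _ l lA.
rewrite -mulrA hat_d_powR //.
apply: le_trans (lambda2_distpow_eps (simple n) (conn n) (r0 n) (rE n) lA).
rewrite ler_wpM2r ?sumr_ge0 // => [i _|]; first exact: sqrtr_ge0.
by lra.
Qed.
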